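(* For every constant $c>0$ there exist $c'>0$ and $n_0$ such that for every $n \ge n_0$, every graph $G$ on $n$ vertices with minimum degree $\delta(G) \ge n/2 + c\sqrt{n}$ satisfies $\operatorname{Cyc}(G) \ge c' 2^n$.
   Context: All graphs are finite and simple. For a graph $G$, a subset $S \subseteq V(G)$ is cyclic if there is a cycle in $G$ whose vertex set is precisely $S$, i.e. the induced subgraph $G[S]$ is Hamiltonian (cycles have at least 3 vertices). $\operatorname{Cyc}(G)$ denotes the number of cyclic subsets of $V(G)$. *)

(* Defs.v *)
From mathcomp Require Import all_boot all_order all_algebra.
From mathcomp Require Import reals.

Set Implicit Arguments.
Unset Strict Implicit.
Unset Printing Implicit Defensive.

Record sgraph (T : finType) := SGraph {
  adj :> rel T;
  adj_sym : symmetric adj;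
  adj_irrefl : irreflexive adj
}.

Definition degree (T : finType) (G : sgraph T) (x : T) : nat :=
  #|[set y | G x y]|.

(* All degrees are < #|T|, so the initial value #|T| never affects the minimum
   when T is inhabited (see [min_degree_attained]). *)
Definition min_degree (T : finType) (G : sgraph T) : nat :=
  \big[minn/#|T|]_(x : T) degree G x.

(* A cycle is given by the sequence of its vertices in cyclic order. The length
   bound matters: [ucycle] by itself admits the empty sequence and an edge
   traversed back and forth. *)
Definition is_cycle (T : finType) (G : sgraph T) (s : seq T) : bool :=
  (3 <= size s) && ucycleb G s.

(* Fixing the length to #|S| is what makes the existential decidable; it loses
   nothing, as a duplicate-free enumeration of S has that length
   (see [cyclic_setP]). *)
Definition cyclic_set (T : finType) (G : sgraph T) (S : {set T}) : bool :=
  [exists s : #|S|.-tuple T, is_cycle G s && ([set x in s] == S)].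

Definition Cyc (T : finType) (G : sgraph T) : nat :=
  #|[set S : {set T} | cyclic_set G S]|.

Lemma cyclic_setP (T : finType) (G : sgraph T) (S : {set T}) :
  reflect (exists2 s : seq T, is_cycle G s & [set x in s] = S)
          (cyclic_set G S).
Proof.
apply: (iffP existsP) => [[s /andP[cs /eqP defS]]|[s cs defS]].
  by exists s.
have szs : size s == #|S|.
  by rewrite -defS cardsE; case/and3P: cs => _ _ /card_uniqP->.
by exists (Tuple szs); rewrite /= cs; apply/eqP; rewrite -[RHS]defS.
Qed.

Lemma min_degree_le (T : finType) (G : sgraph T) (x : T) :
  min_degree G <= degree G x.
Proof.
rewrite /min_degree; have := mem_index_enum x.
elim: (index_enum T) => // y r IHr; rewrite inE big_cons.
by case/predU1P=> [<-|/IHr le_x]; rewrite geq_min ?leqnn // le_x orbT.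
Qed.

Lemma min_degree_attained (T : finType) (G : sgraph T) :
  0 < #|T| -> exists x, min_degree G = degree G x.
Proof.
case/card_gt0P=> x0 _.
have : min_degree G = #|T| \/ exists x, min_degree G = degree G x.
  rewrite /min_degree; elim/big_ind: _ => [|a b Ha Hb|x _]; first by left.
    by case: (leqP a b).
  by right; exists x.
case=> // degT; exists x0; apply/eqP.
by rewrite eqn_leq min_degree_le degT max_card.
Qed.

(* Main.v *)
(* Call S good if every vertex has at least t = (1/4 - eps/4) n neighbours in S
   and fewer than t vertices of S have degree below |S|/2 in G[S].

   A good S is cyclic, by Ore's closure argument: the high vertices may be made
   pairwise adjacent; then their degrees are so large that they may be joined to
   the low vertices; then the low vertices may be joined to each other.

   A uniformly random S is good with probability at least eps/2. The fourth
   moment of a sum of n signs is at most 3n^2, so a union bound handles the first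
   condition up to probability O(1/n). Flipping membership outside the
   neighbourhood of v turns "v is low in S" into "a random subset of n - 1 points
   has at most n - 1 - deg v <= n/2 - c sqrt n elements", which has probability
   at most 1/2 - eps as the gap around the centre has mass bounded below. So the
   expected number of low vertices is at most (1/4 - eps/2) n, and Markov's
   inequality handles the second condition. *)

Require Import Defs.
From mathcomp Require Import all_boot all_order all_algebra.
From mathcomp Require Import reals.
From mathcomp Require Import zify ring lra.

Set Implicit Arguments.
Unset Strict Implicit.
Unset Printing Implicit Defensive.

Import Order.TTheory GRing.Theory Num.Theory.

(** * Hamiltonian cycles and Ore's closure *)

Section OreTransfer.
Variables (T : finType) (S : {set T}).
Implicit Types (e : rel T) (x y z : T) (p : seq T).

(** Stated for a bare relation, so that the auxiliary graphs of the closure argument need no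
    bundling. *)
Definition hamiltonian_on e :=
  exists2 s : seq T, (3 <= size s) && ucycleb e s & [set x in s] = S.

Definition inner_degree e x := #|[set y in S | e x y]|.

(** The measure that [ore_transfer] decreases: the steps of the walk [x :: p] that are not
    [e]-edges. For a closed cycle the walk starts at the last vertex, so that the closing pair
    counts too. *)
Definition gaps e x p := count negb (pairmap e x p).

Lemma gaps_cons e x y p : gaps e x (y :: p) = ~~ e x y + gaps e y p.
Proof. by []. Qed.

Lemma gaps_cat e x p1 p2 :
  gaps e x (p1 ++ p2) = gaps e x p1 + gaps e (last x p1) p2.
Proof. by rewrite /gaps pairmap_cat count_cat. Qed.

Lemma gaps_rev e x p : symmetric e ->
  gaps e (last x p) (rev (belast x p)) = gaps e x p.
Proof.
move=> e_sym; elim: p x => //= y p IHp x.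
rewrite rev_cons -cats1 gaps_cat IHp /gaps /= addn0 addnC; congr (_ + _).
by case: p {IHp} => [|z p] /=; rewrite ?rev_cons ?last_rcons e_sym.
Qed.

Lemma gaps_eq0 e x p : (gaps e x p == 0) = path e x p.
Proof. by elim: p x => //= y p IHp x; rewrite /gaps /= addn_eq0 eqb0 negbK -IHp. Qed.

Lemma gap_split e x p : 0 < gaps e x p ->
  exists p1 y p2, p = p1 ++ y :: p2 /\ ~~ e (last x p1) y.
Proof.
elim: p x => //= y p IHp x; rewrite /gaps /=; case: (boolP (e x y)) => /= exy.
  by case/IHp=> p1 [z [p2 [-> ?]]]; exists (y :: p1), z, p2.
by exists [::], y, p.
Qed.

(** Pigeonhole: if none of the [size p] consecutive pairs met both conditions, each would contribute
    at most one to the sum. *)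
Lemma consecutive_pair (a b : pred T) x p :
    size p < count a p + count b (belast x p) ->
  exists p1 z p2, [/\ p = p1 ++ z :: p2, a z & b (last x p1)].
Proof.
elim: p x => //= z p IHp x lt_ab.
case: (boolP (a z && b x)) => [/andP[az bx]|ab]; first by exists [::], z, p.
have [|p1 [y [p2 [-> ? ?]]]] := IHp z; last by exists (z :: p1), y, p2.
by case: (a z) (b x) ab lt_ab => [] [] //=; lia.
Qed.

Lemma count_inner_degree e y s : uniq s -> [set x in s] = S ->
  count (e y) s = inner_degree e y.
Proof.
move=> Us defS; rewrite /inner_degree -size_filter -(card_uniqP _) ?filter_uniq //.
by apply: eq_card => z; rewrite !inE mem_filter -defS inE andbC.
Qed.

(* Take a Hamiltonian e'-cycle with a non-e edge {y, x}: the degree condition gives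
   consecutive vertices w, z with e x z and e y w, and reversing the segment
   from z to y replaces {w, z}, {y, x} by {w, y}, {z, x}: fewer non-e edges. *)
Lemma ore_transfer e e' : symmetric e -> irreflexive e -> symmetric e' ->
    subrel e e' ->
    (forall x y, x \in S -> y \in S -> e' x y -> ~~ e x y ->
       #|S| <= inner_degree e x + inner_degree e y) ->
  hamiltonian_on e' -> hamiltonian_on e.
Proof.
move=> e_sym e_irr e'_sym sub_e ore [[|x p] //=].
rewrite /ucycleb /= => /andP[size_p /andP[cyc uniq_p] defS].
rewrite -/(cycle e' (x :: p)) (cycle_path x) [last x _]/= in cyc.
have [n] := ubnP (gaps e (last x p) (x :: p)).
elim: n x p size_p cyc uniq_p defS => // n IHn x p size_p cyc uniq_p defS lt_n.
have [/eqP|] := posnP (gaps e (last x p) (x :: p)).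
  rewrite gaps_eq0 => cyc_e; exists (x :: p) => //.
  by rewrite /ucycleb (cycle_path x) /= size_p uniq_p; move: cyc_e => /= ->.
case/gap_split=> p1 [y [p2 [def_p e_y]]].
(* Rotate the cycle so that the gap becomes its closing pair, from [last y q] to [y]. *)
pose q := p2 ++ p1.
have lastq : last y q = last (last x p) p1.
  by rewrite /q last_cat -[last x p]/(last x (x :: p)) def_p last_cat.
have lastp : last x p = last y p2 by rewrite -[last x p]/(last x (x :: p)) def_p last_cat.
have perm_q : perm_eq (x :: p) (y :: q) by rewrite def_p -cat_cons perm_catC.
have {def_p} [cyc_q gaps_q] : path e' (last y q) (y :: q) /\
    gaps e (last y q) (y :: q) = gaps e (last x p) (x :: p).
  move: cyc; rewrite lastq /q -cat_cons def_p lastp !cat_path !gaps_cat /= addnC.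
  by case/andP=> -> /andP[-> ->].
rewrite -gaps_q {gaps_q lastp} in lt_n; rewrite -lastq in e_y.
have size_q : 1 < size q by move: (perm_size perm_q) size_p => /= [<-].
have defSq : [set z in y :: q] = S.
  by rewrite -defS; apply/setP=> z; rewrite !inE -!in_cons (perm_mem perm_q).
have uniq_q : uniq (y :: q) by rewrite -(perm_uniq perm_q).
clearbody q; clear - lt_n e_y size_q defSq uniq_q cyc_q IHn ore e_sym e_irr e'_sym sub_e.
have memS z : (z \in S) = (z \in y :: q) by rewrite -defSq inE.
have cardS : #|S| = (size q).+1 by rewrite -defSq cardsE (card_uniqP uniq_q).
(* By irreflexivity both counts are full inner degrees, so they sum to at least [#|S|], which
   exceeds [size q] by one. *)
have /consecutive_pair[q1 [z [q2 [def_q e_z e_w]]]] :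
    size q < count (e y) q + count (e (last y q)) (belast y q).
  have /= := count_inner_degree e y uniq_q defSq; rewrite e_irr add0n => ->.
  have := count_inner_degree e (last y q) uniq_q defSq.
  rewrite lastI -cats1 count_cat /= e_irr !addn0 => ->.
  rewrite -cardS addnC ore // ?memS ?mem_last ?mem_head //.
  by case/andP: cyc_q.
rewrite {}def_q in lt_n e_y size_q defSq uniq_q cyc_q memS cardS e_w.
rewrite last_cat /= in lt_n e_y cyc_q e_w.
have perm_r : perm_eq (y :: q1 ++ z :: q2) (y :: q1 ++ rev (z :: q2)).
  by rewrite perm_cons perm_cat2l perm_sym perm_rev.
have def_r : rev (z :: q2) = last z q2 :: rev (belast z q2) by rewrite lastI rev_rcons.
have last_r : last y (q1 ++ rev (z :: q2)) = z.
  by rewrite last_cat rev_cons last_rcons.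
apply: (IHn y (q1 ++ rev (z :: q2))); rewrite ?last_r.
- by move: (perm_size perm_r) size_q => /= [<-].
- move: cyc_q; rewrite /= !cat_path def_r /= => /and4P[_ -> _ path_q2].
  rewrite (sub_e _ _ (_ : e z y)) ?[e z y]e_sym // (sub_e _ _ (_ : e _ (last z q2))) 1?e_sym //=.
  by rewrite rev_path (eq_path (e' := e')) // => u v; rewrite e'_sym.
- by move: uniq_q; rewrite (perm_uniq perm_r).
- by rewrite -defSq; apply/setP=> u; rewrite !inE -!in_cons (perm_mem perm_r).
(* Reversal preserves the gaps inside the segment, both new pairs are [e]-edges, and the old closing
   pair was a gap: the measure drops. *)
move: lt_n; rewrite -[y :: _]cat1s -[y :: q1 ++ rev _]cat1s !gaps_cat def_r /=.
rewrite !gaps_cons gaps_rev //.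
have [-> ->] : e z y /\ e (last y q1) (last z q2) by rewrite e_sym e_z e_sym.
by rewrite e_y /gaps /=; lia.
Qed.
End OreTransfer.

Lemma leq_inner_degree (T : finType) (S B : {set T}) (e : rel T) x :
  B \subset S -> (forall y, y \in B -> e x y) -> #|B| <= inner_degree S e x.
Proof.
move=> /subsetP sBS eB; apply/subset_leq_card/subsetP => y By.
by rewrite inE sBS ?eB.
Qed.

Lemma cyclic_set_few_low (T : finType) (G : sgraph T) (S : {set T}) :
    3 <= #|S| ->
    (forall x, x \in S ->
       #|[set y in S | 2 * inner_degree S G y < #|S|]| < inner_degree S G x) ->
  cyclic_set G S.
Proof.
set A := [set y in S | _] => S_ge3 degG.
have sAS : A \subset S by apply/subsetP=> x; rewrite inE => /andP[].
have cardSA : #|S :\: A| = #|S| - #|A| by rewrite cardsD (setIidPr sAS).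
have leAS := subset_leq_card sAS.
have highP x : x \in S -> x \notin A -> #|S| <= 2 * inner_degree S G x.
  by move=> Sx; rewrite inE Sx -leqNgt.
(* [e1] joins high vertices to each other, [e2] also joins high to low, and [e3] is complete.
   Hamiltonicity descends from [e3] to [G] one stage at a time. *)
pose e1 x y := G x y || [&& x != y, x \notin A & y \notin A].
pose e2 x y := G x y || (x != y) && ~~ ((x \in A) && (y \in A)).
pose e3 (x y : T) := x != y.
have G_sym := adj_sym G; have G_irr := adj_irrefl G.
have e1_sym : symmetric e1 by move=> x y; rewrite /e1 G_sym eq_sym [(y \notin A) && _]andbC.
have e2_sym : symmetric e2 by move=> x y; rewrite /e2 G_sym eq_sym [(y \in A) && _]andbC.
have e3_sym : symmetric e3 by move=> x y; rewrite /e3 eq_sym.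
have e1_irr : irreflexive e1 by move=> x; rewrite /e1 G_irr eqxx.
have e2_irr : irreflexive e2 by move=> x; rewrite /e2 G_irr eqxx.
have GN x y : G x y -> x != y by apply: contraTneq => ->; rewrite G_irr.
suffices [s /andP[szs cyc] defS] : hamiltonian_on S G.
  by apply/cyclic_setP; exists s; rewrite // /is_cycle szs.
apply: (ore_transfer (e' := e1)) => //.
- by move=> x y; rewrite /e1 => ->.
- move=> x y Sx Sy; rewrite /e1 => /orP[->//|/and3P[_ xA yA] _].
  by have := highP x Sx xA; have := highP y Sy yA; lia.
apply: (ore_transfer (e' := e2)) => //.
- move=> x y; rewrite /e1 /e2 => /orP[->//|/and3P[-> xA yA]].
  by rewrite (negPf xA) orbT.
- have deg_mix x y : x \in S -> y \in S -> x \notin A ->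
      #|S| <= inner_degree S e1 x + inner_degree S e1 y.
    move=> Sx Sy xA.
    have degy : #|A| < inner_degree S e1 y.
      apply: leq_trans (degG y Sy) (leq_inner_degree _ _) => [|z].
        by apply/subsetP=> z; rewrite inE => /andP[].
      by rewrite inE /e1 => /andP[_ ->].
    (* The unit lost because [x] is not its own neighbour is regained from the strict inequality
       [degy]. *)
    suffices : #|S :\: A| - 1 <= inner_degree S e1 x by lia.
    rewrite (cardsD1 x) in_setD xA Sx add1n subn1; apply: leq_inner_degree => [|z].
      by apply: subset_trans (subD1set _ _) (subsetDl _ _).
    by rewrite in_setD1 in_setD eq_sym /e1 xA => /and3P[-> -> _]; rewrite orbT.
  move=> x y Sx Sy; rewrite {1}/e2 {1}/e1 => /orP[->//|/andP[-> /= xyA]].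
  move=> _; have [xA|xA] := boolP (x \in A); last exact: deg_mix.
  by rewrite addnC deg_mix //; move: xyA; rewrite xA.
apply: (ore_transfer (e' := e3)) => //.
- by move=> x y; rewrite /e2 /e3 => /orP[/GN//|/andP[]].
- move=> x y Sx Sy; rewrite /e3 {1}/e2 => xy; rewrite xy /= => /norP[_]; rewrite negbK.
  case/andP=> xA yA.
  have degA z : z \in A -> #|S| - #|A| <= inner_degree S e2 z.
    move=> zA; rewrite -cardSA; apply: leq_inner_degree => [|t]; first exact: subsetDl.
    rewrite in_setD /e2 => /andP[tA _]; rewrite (negPf tA) andbF /= andbT.
    by rewrite (contraNneq _ tA) ?orbT // => <-.
  (* As [x] is low, [#|A|] is below its degree in [G], hence below half of [#|S|]; so twice
     [#|S| - #|A|] is enough. *)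
  have := degA x xA; have := degA y yA; have := degG x Sx.
  by move: xA; rewrite inE => /andP[_]; lia.
exists (enum S); last by apply/setP=> x; rewrite inE mem_enum.
rewrite -cardE S_ge3 /ucycleb enum_uniq andbT.
have := enum_uniq S; rewrite cardE in S_ge3.
case: (enum S) S_ge3 => // x s size_s; rewrite (cycle_path x) => Us.
have path_s y t : uniq (y :: t) -> path e3 y t.
  elim: t y => //= z t IHt y /andP[]; rewrite inE negb_or => /andP[yz _] Ut.
  by rewrite /e3 yz IHt.
rewrite /= path_s // andbT; apply: contraTneq Us => <-.
by case: s size_s => //= z s _; rewrite mem_last.
Qed.

(** * Comparison of binomial coefficients *)

Lemma leq_bin_mid N j k : j <= k -> j + k <= N -> 'C(N, j) <= 'C(N, k).
Proof.
elim: N j k => [|N IHN] j k le_jk le_N.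
  by have [-> ->] : j = 0 /\ k = 0 by lia.
case: j k le_jk le_N => [|j] [|k] le_jk le_N //; first by rewrite bin0 bin_gt0; lia.
have [->|ne_jk] := eqVneq j k; first by [].
rewrite !binS.
have [le_N'|lt_N] := leqP (j.+1 + k.+1) N.
  by rewrite leq_add // IHN; lia.
(* On the boundary [j.+1 + k.+1 = N.+1] the Pascal summands must be compared crosswise. *)
rewrite addnC leq_add ?IHN //; lia.
Qed.

(* With s about sqrt N, the near-central coefficients below K are at most s many
   and each is at most 'C(N, K), while each of the w = N - 2K - 1 coefficients
   strictly between K and N - K is at least 'C(N, K). *)
Lemma sum_bin_le_of_far_tail (N s a K : nat) :
    16 * (\sum_(k < a) 'C(N, k)) <= 3 * 2 ^ N -> 2 * K < N -> K < s + a ->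
  (\sum_(k < K.+1) 'C(N, k)) * (16 * (N - 2 * K - 1) + 32 * s) <=
  2 ^ N * (3 * (N - 2 * K - 1) + 16 * s).
Proof.
move=> far_tail K_lt K_a.
set L := \sum_(k < _) _; set w := N - 2 * K - 1.
have le_near : L <= \sum_(k < a) 'C(N, k) + s * 'C(N, K).
  rewrite /L -!(big_mkord xpredT).
  have [le_a|/ltnW lt_a] := leqP a K.+1.
    rewrite (big_cat_nat (n := a)) //= leq_add2l.
    apply: leq_trans (_ : \sum_(a <= k < K.+1) 'C(N, K) <= _).
      by rewrite big_nat [leqRHS]big_nat leq_sum // => k /andP[_ lt_k]; rewrite leq_bin_mid; lia.
    by rewrite sum_nat_const_nat leq_mul2r; apply/orP; right; lia.
  rewrite [in leqRHS](big_cat_nat (n := K.+1)) //= -addnA leq_addr //.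
have le_mid : 2 * L + w * 'C(N, K) <= 2 ^ N.
  rewrite -[2](addn1 1) expnDn.
  under eq_bigr do rewrite !exp1n !muln1.
  rewrite -(big_mkord xpredT (fun k => 'C(N, k))) (big_cat_nat (n := K.+1)) //=; last by lia.
  rewrite (@big_cat_nat _ _ _ (N - K) K.+1) //=; try lia.
  have -> : \sum_(N - K <= k < N.+1) 'C(N, k) = L.
    rewrite /L -(big_mkord xpredT) -{1}[N - K]add0n big_addn big_nat_rev.
    rewrite (_ : N.+1 - (N - K) = K.+1); last by lia.
    apply: eq_big_nat => k /andP[_ lt_k].
    by rewrite -[LHS]bin_sub; [congr 'C(_, _); lia|lia].
  rewrite big_mkord -/L.
  have : w * 'C(N, K) <= \sum_(K.+1 <= k < N - K) 'C(N, k); last lia.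
  apply: leq_trans (_ : \sum_(K.+1 <= k < N - K) 'C(N, K) <= _).
    by rewrite sum_nat_const_nat leq_mul2r; apply/orP; right; lia.
  by rewrite big_nat [leqRHS]big_nat leq_sum // => k /andP[gt_k lt_k]; rewrite leq_bin_mid; lia.
(* Weighting [le_near] by [w] and [le_mid] by [s] eliminates [b]:
   [L * (w + 2 * s) <= X * w + s * 2 ^ N]. *)
move: far_tail le_near le_mid; set X := \sum_(k < a) _; set b := 'C(N, K); nia.
Qed.
Local Open Scope ring_scope.

(** * Moments of a sum of random signs *)

Section RandomSubset.
Variables (R : realFieldType) (T : finType).
Implicit Types (A S : {set T}) (x : T).

(** For uniform [S] the spins are independent signs. Expectations appear as sums over all [S], hence
    the factors [2 ^+ #|T|] below. *)
Definition spin x S : R := (-1) ^+ (x \notin S).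
Definition bias A S : R := \sum_(x in A) spin x S.
Definition toggle x S : {set T} := if x \in S then S :\ x else x |: S.

Lemma biasE A S : bias A S = 2 * #|A :&: S|%:R - #|A|%:R.
Proof.
rewrite /bias (bigID (mem S)) /= -(cardsID S A) natrD.
rewrite (eq_bigr (fun=> 1)); last by move=> x /andP[_ Sx]; rewrite /spin Sx.
rewrite [X in _ + X](eq_bigr (fun=> -1)); last by move=> x /andP[_ Sx]; rewrite /spin Sx.
rewrite sumrN !sumr_const.
rewrite (eq_card (B := A :&: S)); last by move=> x; rewrite !inE.
rewrite [X in - (_ *+ X)](eq_card (B := A :\: S)); last by move=> x; rewrite !inE andbC.
ring.
Qed.

Lemma in_toggle x y S : (y \in toggle x S) = (y == x) (+) (y \in S).
Proof.
rewrite /toggle; case: ifPn => xS; rewrite !inE;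
  by case: eqVneq => [->|]; rewrite ?xS ?(negPf xS).
Qed.

Lemma toggleK x : involutive (toggle x).
Proof. by move=> S; apply/setP=> y; rewrite !in_toggle addbA addbb. Qed.

Lemma spin_toggle x S : spin x (toggle x S) = - spin x S.
Proof. by rewrite /spin in_toggle eqxx; case: (x \in S); rewrite /= ?opprK ?expr0 ?expr1. Qed.

Lemma bias_toggle x A S : x \notin A -> bias A (toggle x S) = bias A S.
Proof.
move=> xA; apply: eq_bigr => y Ay; rewrite /spin in_toggle.
by have /negPf-> : y != x by apply: contraNneq xA => <-.
Qed.

(** Stands in for independence: [toggle x] negates the spin at [x] and keeps the bias of [A], so the
    sum equals its own negative. *)
Lemma sum_odd_spin (f : R -> R) x A : x \notin A -> \sum_S f (bias A S) * spin x S = 0.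
Proof.
move=> xA; apply/eqP; rewrite -eqNr -sumrN; apply/eqP.
rewrite [RHS](reindex_inj (inv_inj (toggleK x))); apply: eq_bigr => S _.
by rewrite spin_toggle bias_toggle // mulrN.
Qed.

Lemma spin_sqr x S : spin x S ^+ 2 = 1.
Proof. by rewrite /spin sqrr_sign. Qed.

(** Induction removing one point of [A]: even powers of its spin are 1 and odd ones cancel by
    [sum_odd_spin]. The two moments go together because the fourth-power recursion involves the
    second moment. *)
Lemma bias_moments A :
  \sum_S bias A S ^+ 2 = #|A|%:R * 2 ^+ #|T| /\
  \sum_S bias A S ^+ 4 = (3 * #|A|%:R ^+ 2 - 2 * #|A|%:R) * 2 ^+ #|T|.
Proof.
have cardT : \sum_(S : {set T}) (1 : R) = 2 ^+ #|T|.
  by have := card_powerset [set: T]; rewrite powersetT !cardsT sumr_const => ->; rewrite natrX.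
have [m] := ubnP #|A|; elim: m A => // m IHm A lt_m.
have [->|/set0Pn[x Ax]] := eqVneq A set0.
  rewrite cards0 mul0r expr0n /= !mulr0 subr0 mul0r.
  by rewrite !big1 // => S _; rewrite /bias big_set0 expr0n.
have xA : x \notin A :\ x by rewrite !inE eqxx.
rewrite (cardsD1 x) Ax add1n ltnS in lt_m.
have [IH2 IH4] := IHm _ lt_m.
have biasA S : bias A S = spin x S + bias (A :\ x) S.
  by rewrite -{1}(setD1K Ax) /bias big_setU1.
rewrite (cardsD1 x A) Ax natrD /=; split.
  transitivity (\sum_S (bias (A :\ x) S ^+ 2 + 1 + (2 * bias (A :\ x) S) * spin x S)).
    by apply: eq_bigr => S _; rewrite biasA sqrrD spin_sqr; ring.
  rewrite !big_split /= IH2 cardT (sum_odd_spin (fun y => 2 * y)) //; ring.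
transitivity (\sum_S (bias (A :\ x) S ^+ 4 + 6 * bias (A :\ x) S ^+ 2 + 1 +
    (4 * bias (A :\ x) S + 4 * bias (A :\ x) S ^+ 3) * spin x S)).
  apply: eq_bigr => S _; rewrite biasA.
  have := spin_sqr x S; set e := spin x S => e2.
  set X := bias _ _.
  have -> : (e + X) ^+ 4 = (e ^+ 2) ^+ 2 + 4 * e * e ^+ 2 * X + 6 * e ^+ 2 * X ^+ 2
      + 4 * e * X ^+ 3 + X ^+ 4 by ring.
  by rewrite e2; ring.
rewrite !big_split /= -mulr_sumr IH2 IH4 cardT.
rewrite (sum_odd_spin (fun y => 4 * y + 4 * y ^+ 3)) //; ring.
Qed.

(** Markov's inequality for the fourth power; a second-moment bound would not survive the union
    bound over vertices. *)
Lemma bias_tail A (t : R) : 0 <= t ->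
  #|[set S | t <= `|bias A S|]|%:R * t ^+ 4 <= 3 * #|A|%:R ^+ 2 * 2 ^+ #|T|.
Proof.
move=> t_ge0; have [_ m4] := bias_moments A.
apply: le_trans (_ : \sum_S bias A S ^+ 4 <= _); last first.
  rewrite m4 ler_wpM2r ?exprn_ge0 // lerBlDr lerDl; apply: mulr_ge0 => //; exact: ler0n.
rewrite (bigID (fun S => t <= `|bias A S|)) /= -[leLHS]addr0 lerD //; last first.
  by apply: sumr_ge0 => S _; rewrite exprn_even_ge0.
rewrite mulr_natl -sumr_const big_mkcond [leRHS]big_mkcond; apply: ler_sum => S _.
rewrite inE; case: ifP => // le_t; rewrite -[leRHS]ger0_norm ?exprn_even_ge0 //.
by rewrite normrX lerXn2r // nnegrE.
Qed.
End RandomSubset.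

(** * Lower binomial tails bounded away from one half *)

Lemma card_small_subsets (T : finType) (A : {set T}) (a : nat) :
  #|[set B : {set T} | B \subset A & (#|B| < a)%N]| = (\sum_(k < a) 'C(#|A|, k))%N.
Proof.
elim: a => [|a IHa].
  by rewrite big_ord0; apply: eq_card0 => B; rewrite inE ltn0 andbF.
rewrite big_ord_recr /= -IHa -cards_draws -[LHS](cardsID [set B : {set T} | (#|B| < a)%N]).
congr (_ + _)%N; apply: eq_card => B; rewrite !inE ltnS.
  by case: (B \subset A) => //=; case: ltngtP.
by case: (B \subset A); rewrite ?andbF //=; case: ltngtP.
Qed.

Lemma binomial_tail (N s K : nat) : (2 * K < N)%N -> (N <= s ^ 2)%N ->
  ((\sum_(k < K.+1) 'C(N, k)) * (16 * (N - 2 * K - 1) + 32 * s) <=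
   2 ^ N * (3 * (N - 2 * K - 1) + 16 * s))%N.
Proof.
move=> lt_K le_N; have s_gt0 : (0 < s)%N by case: s le_N => //; lia.
(* A set below this cutoff has bias at most [- 2 * s]. The fourth-moment bound at [2 * s], with
   [N <= s ^ 2], gives proportion at most 3/16, the constant in [far_tail]. *)
apply: (@sum_bin_le_of_far_tail _ _ (N./2.+1 - s)) => //; last by lia.
have := card_small_subsets [set: 'I_N] (N./2.+1 - s); rewrite cardsT card_ord => <-.
set B := [set B | _].
have /(@bias_tail rat _ [set: 'I_N]) : 0 <= (2 * s)%:R :> rat by [].
rewrite cardsT card_ord => tail.
have le_B : (#|B| * (2 * s) ^ 4 <= 3 * N ^ 2 * 2 ^ N)%N.
  rewrite -(ler_nat rat) !natrM !natrX; apply: le_trans tail.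
  rewrite natrM ler_wpM2r ?exprn_ge0 ?mulr_ge0 // ler_nat subset_leq_card //.
  apply/subsetP=> S; rewrite !inE subsetT /= => lt_S.
  rewrite ler_normr; apply/orP; right; rewrite biasE setTI cardsT card_ord.
  suffices : (2 * s + 2 * #|S| <= N)%N by rewrite -(ler_nat rat) natrD !natrM; lra.
  by move: #|_| lt_S => x; lia.
have le_N2 : (N ^ 2 <= s ^ 4)%N by rewrite -[4%N]/(2 * 2)%N expnM leq_exp2r.
rewrite -(leq_pmul2r (m := s ^ 4)) ?expn_gt0 ?s_gt0 //.
apply: leq_trans (leq_trans le_B _); first by rewrite expnMn; lia.
by rewrite [leqRHS]mulnAC leq_mul // leq_mul.
Qed.

(** With [w = N - 2 * K - 1], the ratio from [binomial_tail] is [1/2 - 5 * w / (16 * w + 32 * s)],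
    which decreases in [w]; its value at [w = c * s] is the stated bound. *)
Lemma binomial_tail_real (R : realFieldType) (c : R) (N s K : nat) : 0 < c ->
    (2 * K < N)%N -> (N <= s ^ 2)%N -> c * s%:R <= (N - 2 * K - 1)%:R ->
  (\sum_(k < K.+1) 'C(N, k))%:R <= (2^-1 - 5 * c / (16 * c + 32)) * 2 ^+ N.
Proof.
move=> c_gt0 lt_K le_N; have := binomial_tail lt_K le_N.
set L := (\sum_(k < _) _)%N; set w := (N - _ - _)%N.
rewrite -(ler_nat R) !(natrM, natrD, natrX) => tail le_w.
have s_gt0 : 0 < s%:R :> R by rewrite ltr0n; case: (s) le_N => //; lia.
have cs_gt0 := mulr_gt0 c_gt0 s_gt0.
have D_gt0 : 0 < 16 * w%:R + 32 * s%:R :> R by lra.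
rewrite -(ler_pM2r D_gt0); apply: le_trans tail _.
rewrite [leRHS]mulrAC [leRHS]mulrC ler_pM2l ?exprn_gt0 //.
have c_den : 0 < 16 * c + 32 by lra.
rewrite -(ler_pM2r c_den) [leRHS](_ : _ =
  (8 * w%:R + 16 * s%:R) * (16 * c + 32) - 5 * c * (16 * w%:R + 32 * s%:R)).
  by nra.
by field; rewrite gt_eqF.
Qed.

(** * Counting the sets that fail to be good *)

Section Counting.
Variables (T : finType) (G : sgraph T).

Definition low_vertices (S : {set T}) := [set x in S | (2 * inner_degree S G x < #|S|)%N].

Lemma card_low_at v :
  (#|[set S | v \in low_vertices S]| <=
   \sum_(k < (#|T| - 1 - degree G v).+1) 'C(#|T| - 1, k))%N.
Proof.
have cardV : #|[set~ v]| = (#|T| - 1)%N by rewrite cardsC1 subn1.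
rewrite -cardV -card_small_subsets.
(* F flips membership at the non-neighbours of v, so for S containing v, S is low
   at v exactly when F S has at most #|T| - 1 - degree G v elements. *)
pose F (S : {set T}) := [set y | (y != v) && ((y \in S) == G v y)].
rewrite -(card_in_imset (f := F)) => [|S S']; last first.
  rewrite !inE => /andP[vS _] /andP[vS' _] /setP eqF; apply/setP=> y.
  have [->|yv] := eqVneq y v; first by rewrite vS vS'.
  by have := eqF y; rewrite !inE yv /=; case: (y \in S) (y \in S') (G v y) => [] [] [].
apply/subset_leq_card/subsetP => _ /imsetP[S + ->].
rewrite !inE => /andP[vS low]; apply/andP; split.
  by apply/subsetP=> y; rewrite !inE => /andP[].
pose N := [set y | G v y].
have Nv : v \notin N by rewrite inE adj_irrefl.
have defX : inner_degree S G v = #|S :&: N| by apply: eq_card => y; rewrite !inE.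
have cardS : (#|S| = #|S :&: N| + #|S :\: N :\ v| + 1)%N.
  by rewrite -(cardsID N S) (cardsD1 v (S :\: N)) in_setD Nv vS; lia.
have cardF : (#|F S| = #|S :&: N| + #|~: S :\: N|)%N.
  rewrite -(cardsID S (F S)); congr (_ + _)%N; apply: eq_card => y; rewrite !inE.
    have [->|yv] := eqVneq y v; first by rewrite adj_irrefl !andbF.
    by case: (y \in S) (G v y) => [] [].
  have [->|yv] := eqVneq y v; first by rewrite vS !andbF.
  by case: (y \in S) (G v y) => [] [].
have cardT : (#|T| = #|N| + #|S :\: N :\ v| + 1 + #|~: S :\: N|)%N.
  rewrite -cardsT -(cardsID N) setTI -(cardsID S (setT :\: N)) !addnA.
  congr (_ + _)%N; last by apply: eq_card => y; rewrite !inE andbT andbC.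
  rewrite -!addnA; congr (_ + _)%N; rewrite addn1.
  rewrite (cardsD1 v) !in_setI !in_setD vS Nv inE add1n; congr _.+1.
  by apply: eq_card => y; rewrite !inE andbT; do !case: (_ == _); rewrite //= andbC.
(* Lowness says [#|S :&: N| <= #|S :\: N :\ v|]; adding [#|~: S :\: N|] to both sides bounds
   [#|F S|]. *)
rewrite /degree -/N; rewrite defX in low; lia.
Qed.

Variable R : realFieldType.

Definition poor_sets (t : R) : {set {set T}} :=
  [set S | [exists v, (inner_degree S G v)%:R < t]].

Definition low_heavy_sets (t : R) : {set {set T}} :=
  [set S | t <= #|low_vertices S|%:R].

(** Markov's inequality, after double counting the pairs of a set and a vertex low in it. *)
Lemma card_low_heavy_sets (b : R) (t : R) : 0 <= t ->
    (forall v, #|[set S | v \in low_vertices S]|%:R <= b) ->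
  #|low_heavy_sets t|%:R * t <= #|T|%:R * b.
Proof.
move=> t_ge0 le_b.
apply: le_trans (_ : \sum_S #|low_vertices S|%:R <= _).
  rewrite mulr_natl -sumr_const big_mkcond; apply: ler_sum => S _.
  by rewrite inE; case: ifP.
have -> : \sum_S #|low_vertices S|%:R = \sum_v #|[set S | v \in low_vertices S]|%:R :> R.
  transitivity (\sum_S \sum_v (v \in low_vertices S)%:R : R).
    apply: eq_bigr => S _; rewrite -sum1_card natr_sum big_mkcond.
    by apply: eq_bigr => v _; case: ifP.
  rewrite exchange_big; apply: eq_bigr => v _.
  by rewrite -sum1_card natr_sum [RHS]big_mkcond; apply: eq_bigr => S _; rewrite inE; case: ifP.
by rewrite mulr_natl -sumr_const; apply: ler_sum.
Qed.

(** A vertex with fewer than [t] neighbours in [S] forces the bias of its neighbourhood below [- u];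
    [bias_tail] and a union bound over the vertices finish. *)
Lemma card_poor_sets (t u : R) : 0 <= u ->
    (forall v, 2 * t + u <= (degree G v)%:R) ->
  #|poor_sets t|%:R * u ^+ 4 <= 3 * #|T|%:R ^+ 3 * 2 ^+ #|T|.
Proof.
move=> u_ge0 le_deg.
pose N v := [set y | G v y].
pose D v := [set S | u <= `|bias R (N v) S|].
have le_poor : #|poor_sets t|%:R <= \sum_v #|D v|%:R :> R.
  rewrite -natr_sum ler_nat.
  apply: leq_trans (_ : (#|\bigcup_v D v| <= _)%N).
    apply/subset_leq_card/subsetP => S; rewrite inE => /existsP[v poor].
    apply/bigcupP; exists v => //; rewrite inE ler_normr biasE; apply/orP; right.
    have <- : inner_degree S G v = #|N v :&: S| by apply: eq_card => y; rewrite !inE andbC.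
    have := le_deg v; rewrite /degree -/(N v); lra.
  elim/big_rec2: _ => [|v m A _ IH]; first by rewrite cards0.
  by apply: leq_trans (leq_card_setU _ _) _; rewrite leq_add2l.
apply: le_trans (_ : \sum_v #|D v|%:R * u ^+ 4 <= _).
  by rewrite -mulr_suml ler_wpM2r ?exprn_ge0.
have -> : 3 * #|T|%:R ^+ 3 * 2 ^+ #|T| = \sum_(v : T) (3 * #|T|%:R ^+ 2 * 2 ^+ #|T|) :> R.
  rewrite sumr_const -mulr_natl; ring.
apply: ler_sum => v _; apply: le_trans (bias_tail (N v) u_ge0) _.
rewrite ler_wpM2r ?exprn_ge0 // ler_wpM2l // lerXn2r ?nnegrE // ler_nat max_card //.
Qed.

End Counting.

(** * Good sets are cyclic, and the final estimate *)

Lemma cyclic_of_not_bad (T : finType) (G : sgraph T) (R : realFieldType) (t : R)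
    (S : {set T}) : (0 < #|T|)%N -> 2 <= t ->
  S \notin poor_sets G t -> S \notin low_heavy_sets G t -> cyclic_set G S.
Proof.
case/card_gt0P=> v _ t_ge2; rewrite !inE negb_exists -ltNge => /forallP rich few.
have {}rich x : t <= (inner_degree S G x)%:R by rewrite leNgt.
have le_deg x : (inner_degree S G x <= #|S|)%N.
  by apply/subset_leq_card/subsetP => y; rewrite inE => /andP[].
have deg_ge2 x : (2 <= inner_degree S G x)%N by rewrite -(ler_nat R) (le_trans t_ge2).
(* Here [2 <= t] yields [3 <= #|S|]: a member [u] of [S] together with two neighbours in [S]. *)
have [u] : exists u, u \in S.
  by apply/card_gt0P; apply: leq_trans (le_deg v); apply: ltnW.
move=> Su; apply: cyclic_set_few_low => [|x _]; last first.
  by rewrite -(ltr_nat R) (lt_le_trans few).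
rewrite (cardsD1 u) Su add1n ltnS; apply: leq_trans (deg_ge2 u) _.
apply/subset_leq_card/subsetP => y; rewrite !inE => /andP[-> uy]; rewrite andbT.
by apply: contraTneq uy => ->; rewrite adj_irrefl.
Qed.

Lemma degree_lt (T : finType) (G : sgraph T) v : (degree G v < #|T|)%N.
Proof.
rewrite -cardsT; apply/proper_card/properP; split; first exact: subsetT.
by exists v; rewrite ?inE ?adj_irrefl.
Qed.

Lemma card_low_at_real (R : realType) (c : R) (T : finType) (G : sgraph T) v :
    0 < c -> (1 < #|T|)%N ->
    #|T|%:R / 2 + c * Num.sqrt #|T|%:R <= (degree G v)%:R ->
  #|[set S | v \in low_vertices G S]|%:R <=
    (4^-1 - (5 * c / (16 * c + 32)) / 2) * 2 ^+ #|T|.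
Proof.
move=> c_gt0 T_gt1 le_deg; set r := Num.sqrt _ in le_deg.
have n_ge0 : 0 <= #|T|%:R :> R by [].
have r2 : r ^+ 2 = #|T|%:R by rewrite sqr_sqrtr.
have n_ge1 : 1 <= #|T|%:R :> R by rewrite ler1n ltnW.
have r_ge1 : 1 <= r by rewrite -(ler_pXn2r (n := 2)) ?nnegrE ?sqrtr_ge0 // r2 expr1n.
have r_ge0 : 0 <= r by apply: sqrtr_ge0.
(* Since [r < s <= r + 1 <= 2 * r], the square of [s] exceeds [#|T|], while the degree surplus
   [2 * c * r] is still at least [c * s]. *)
pose s := (Num.truncn r).+1.
have lt_s : r < s%:R by rewrite truncnS_gt.
have le_s : s%:R <= r + 1 by rewrite /s -addn1 natrD lerD2r truncn_le.
have ltd := degree_lt G v.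
have cr_gt0 : 0 < c * r by nra.
have lt_2d : (#|T| < 2 * degree G v)%N by rewrite -(ltr_nat R) natrM; lra.
(* Only the [#|T| - 1] points other than [v] are random, as [v] must lie in [S]; this halves the
   proportion. *)
apply: le_trans (_ : (2^-1 - 5 * c / (16 * c + 32)) * 2 ^+ (#|T| - 1) <= _); last first.
  by rewrite -[in leRHS](subnK (ltnW T_gt1)) addn1 exprS; lra.
apply: le_trans (binomial_tail_real (s := s)
  (K := #|T| - 1 - degree G v) c_gt0 _ _ _); first by rewrite ler_nat card_low_at.
- by lia.
- rewrite -(ler_nat R) natrX; apply: le_trans (_ : #|T|%:R <= _); first by rewrite ler_nat leq_subr.
  by rewrite -r2 lerXn2r ?nnegrE // ltW.
- have -> : (#|T| - 1 - 2 * (#|T| - 1 - degree G v) - 1 = 2 * degree G v - #|T|)%N by lia.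
  rewrite natrB ?(ltnW lt_2d) // natrM; nra.
Qed.

Theorem proposition1p3 (R : realType) (c : R) (c_gt0 : 0 < c) :
  exists2 c' : R, 0 < c' &
  exists n0 : nat, forall n : nat, (n0 <= n)%N ->
  forall (T : finType) (G : sgraph T), #|T| = n ->
    n%:R / 2 + c * Num.sqrt n%:R <= (min_degree G)%:R ->
    c' * 2 ^+ n <= (Cyc G)%:R.
Proof.
pose eps := 5 * c / (16 * c + 32).
have den_gt0 : 0 < 16 * c + 32 by lra.
have eps_gt0 : 0 < eps by rewrite divr_gt0 ?mulr_gt0.
have eps_lt : eps < 5 / 16 by rewrite ltr_pdivrMr //; lra.
pose m := 3 / ((eps / 2) ^+ 4 * (eps / 2)).
have e2_gt0 : 0 < eps / 2 by rewrite divr_gt0.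
exists (eps / 2) => //.
(* The bound 16 ensures [2 <= t], given [eps < 5 / 16]; exceeding [m] brings the proportion of poor
   sets down to [eps / 2]. *)
exists (maxn 16 (Num.truncn m).+1) => n + T G cardT; rewrite -{n}cardT.
rewrite geq_max => /andP[n_ge16 n_gt_m] min_deg.
have n_ge16R : 16 <= #|T|%:R :> R by rewrite ler_nat.
have le_deg v : #|T|%:R / 2 + c * Num.sqrt #|T|%:R <= (degree G v)%:R.
  by apply: le_trans min_deg _; rewrite ler_nat min_degree_le.
have crt_ge0 : 0 <= c * Num.sqrt #|T|%:R by rewrite mulr_ge0 ?sqrtr_ge0 ?ltW.
(* This threshold leaves slack [eps / 2 * #|T|] between [2 * t] and half of [#|T|], and Markov's
   ratio [(1/4 - eps/2) / (1/4 - eps/4)] is at most [1 - eps]. *)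
pose t : R := (4^-1 - eps / 4) * #|T|%:R.
have t_ge2 : 2 <= t by rewrite /t; nra.
have le_low := card_low_heavy_sets (le_trans (ler0n R 2) t_ge2)
  (fun v => card_low_at_real c_gt0 (leq_trans (isT : (1 < 16)%N) n_ge16) (le_deg v)).
have le_poor : #|poor_sets G t|%:R <= eps / 2 * 2 ^+ #|T|.
  have e4_gt0 : 0 < (eps / 2) ^+ 4 by rewrite exprn_gt0.
  have big_n : 3 <= (eps / 2) ^+ 4 * (eps / 2) * #|T|%:R.
    rewrite mulrC -ler_pdivrMr ?(mulr_gt0 e4_gt0 e2_gt0) // ltW //.
    by rewrite (lt_le_trans (truncnS_gt m)) ?ler_nat.
  have u_ge0 : 0 <= eps / 2 * #|T|%:R by rewrite mulr_ge0 // ltW.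
  have deg_u v : 2 * t + eps / 2 * #|T|%:R <= (degree G v)%:R.
    by apply: le_trans (le_deg v); rewrite /t; lra.
  have := card_poor_sets u_ge0 deg_u.
  rewrite exprMn => le_poor.
  have n_gt0 : 0 < #|T|%:R :> R by lra.
  rewrite -(ler_pM2r (mulr_gt0 e4_gt0 (exprn_gt0 4 n_gt0))); apply: le_trans le_poor _.
  rewrite [leRHS](_ : _ = (eps / 2) ^+ 4 * (eps / 2) * #|T|%:R *
    (#|T|%:R ^+ 3 * 2 ^+ #|T|)); last by ring.
  by rewrite -mulrA ler_wpM2r // mulr_ge0 ?exprn_ge0 ?ltW.
have {}le_low : #|low_heavy_sets G t|%:R <= (1 - eps) * 2 ^+ #|T|.
  have t_gt0 : 0 < t by lra.
  rewrite -(ler_pM2r t_gt0); apply: le_trans le_low _.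
  rewrite mulrA [leRHS]mulrAC ler_wpM2r ?exprn_ge0 // -/eps /t mulrA mulrC.
  by rewrite ler_wpM2r //; nra.
(* The proportion left for cyclic sets is [1 - (1 - eps) - eps / 2 = eps / 2]. *)
have cover : 2 ^+ #|T| <= (Cyc G)%:R + #|low_heavy_sets G t|%:R + #|poor_sets G t|%:R :> R.
  rewrite -natrX -!natrD ler_nat.
  have := card_powerset [set: T]; rewrite powersetT (cardsT T) => <-.
  apply: leq_trans (leq_trans (leq_card_setU (_ :|: _) _) (leq_add (leq_card_setU _ _) (leqnn _))).
  apply/subset_leq_card/subsetP => S _; rewrite !in_setU.
  have [_|poor] := boolP (S \in poor_sets G t); first by rewrite orbT.
  have [_|low] := boolP (S \in low_heavy_sets G t); first by rewrite orbT.
  by rewrite inE (cyclic_of_not_bad _ t_ge2 poor low) // (leq_trans _ n_ge16).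
lra.
Qed.
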